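(* For every integer $n\ge0$, the total number of inversions over all involutions of $[n]$ is $$i_n^{(1)}=\binom{n}{2}r_{n-2}^{(1)}+2\binom{n}{3}r_{n-3}^{(1)}+6\binom{n}{4}r_{n-4}^{(1)}.$$
   Context: An involution of $[n]$ is a permutation $\pi$ of $[n]$ with $\pi\circ\pi=\mathrm{id}$. $r_m^{(1)}$ is the number of involutions of $[m]$ for $m\ge0$ ($r_0^{(1)}=1$), with $r_m^{(1)}=0$ for $m<0$. For a permutation $\pi$, $\mathrm{inv}(\pi)=|\{(i,j):i<j,\ \pi_i>\pi_j\}|$, and $i_n^{(1)}=\sum\mathrm{inv}(\pi)$ over all involutions $\pi$ of $[n]$. *)

(* Defs.v *)
From mathcomp Require Import all_boot all_order all_fingroup all_algebra.

Set Implicit Arguments.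
Unset Strict Implicit.
Unset Printing Implicit Defensive.

(* The group law on 'S_n is composition, so s * s = 1 says that s \o s = id;
   the identity counts as an involution. *)
Definition involutions (n : nat) : {set 'S_n} := [set s : 'S_n | (s * s == 1)%g].

Definition inv (n : nat) (s : 'S_n) : nat :=
  #|[set p : 'I_n * 'I_n | (p.1 < p.2) && (s p.1 > s p.2)]|.

(* The index is an integer so that r1 (n - k) really is 0 when n < k; with
   truncated subtraction on nat it would be r1 0 = 1. *)
Definition r1 (m : int) : nat :=
  match m with
  | Posz k => #|involutions k|
  | Negz _ => 0
  end.

Definition i1 (n : nat) : nat := \sum_(s in involutions n) inv s.

(* Main.v *)
Require Import Defs.
From mathcomp Require Import all_boot all_order all_fingroup all_algebra.
From mathcomp Require Import zify.

(* An inversion i < j, s j < s i of an involution s falls into one of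
   three cases: s may swap i and j, fix one of them and move the other, or
   move both to new points. Prescribing s on a set of size k that it preserves
   leaves r_(n-k) involutions, so it suffices to count the configurations:
   C(n,2) swapped pairs; C(n,3) triples for each choice of the fixed point;
   and C(n,2) C(n-2,2) = 6 C(n,4) disjoint pairs of pairs i < j, s j < s i. *)

Set Implicit Arguments.
Unset Strict Implicit.
Unset Printing Implicit Defensive.

(** * Involutions supported in a subset *)

Section InvolutionsOn.
Variable T : finType.
Implicit Types (A B : {set T}) (s t : {perm T}).

(** Involutions of the subset [B] are kept as permutations of all of [T] that fix every point
    outside [B], so that removing points from [B] does not change the type. *)
Definition involutions_on B : {set {perm T}} :=
  [set s : {perm T} | (s * s == 1)%g && perm_on B s].

Lemma involutions_onP B s :
  reflect (involutive s /\ perm_on B s) (s \in involutions_on B).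
Proof.
rewrite inE; apply: (iffP andP) => -[sK Bs]; split=> //.
  by move=> x; rewrite -permM (eqP sK) perm1.
by apply/eqP/permP => x; rewrite permM sK perm1.
Qed.

(** Multiplication by [t] is the bijection. If [s] agrees with [t] on [A], then [t * s] fixes [A]
    pointwise and acts as [s] elsewhere. Conversely, an involution [u] supported in [B :\: A]
    commutes with [t], as their supports are disjoint, so [t * u] is again an involution. *)
Lemma card_involutions_extending A B t :
  A \subset B -> t \in involutions_on A ->
  #|[set s in involutions_on B | [forall x in A, s x == t x]]|
    = #|involutions_on (B :\: A)|.
Proof.
move=> sAB /involutions_onP [tK At].
have tt1 : (t * t = 1)%g by apply/permP => x; rewrite permM tK perm1.
have tA x : x \in A -> t x \in A by move=> Ax; rewrite (perm_closed x At).
rewrite -(card_imset (mem (involutions_on (B :\: A))) (mulgI t)).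
apply: eq_card => s; apply/idP/imsetP.
- rewrite inE => /andP[/involutions_onP[sK Bs] /forall_inP st].
  exists (t * s)%g; last by rewrite mulgA tt1 mul1g.
  have fixA x : x \in A -> s (t x) = x.
    by move=> Ax; rewrite (eqP (st _ (tA _ Ax))) tK.
  apply/involutions_onP; split=> [x|].
    rewrite !permM; have [Ax|nAx] := boolP (x \in A); first by rewrite !fixA.
    have nAsx : s x \notin A.
      apply: contra nAx => Asx.
      by rewrite -(sK x) (eqP (st _ Asx)) tA.
    by rewrite (out_perm At nAx) (out_perm At nAsx) sK.
  apply/subsetP => x; rewrite !inE permM; apply: contraR.
  rewrite negb_and negbK => /orP[/fixA->//|nBx].
  have nAx : x \notin A by apply: contra nBx; apply: (subsetP sAB).
  by rewrite (out_perm At nAx) (out_perm Bs nBx).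
- case=> u /involutions_onP[uK BAu] ->.
  have ut : (t * u = u * t)%g.
    by apply: perm_onC At BAu _; rewrite disjoints_subset setCD subsetUr.
  rewrite inE; apply/andP; split.
    apply/involutions_onP; split.
      by move=> x; rewrite {1}ut !permM uK tK.
    apply: perm_onM; first exact: subset_trans At sAB.
    exact: subset_trans BAu (subsetDl _ _).
  apply/forall_inP => x Ax.
  by rewrite ut permM (out_perm BAu) // inE Ax.
Qed.

Lemma tperm_involutions_on A x y :
  x \in A -> y \in A -> tperm x y \in involutions_on A.
Proof.
move=> Ax Ay; apply/involutions_onP; split; first exact: tpermK.
apply: subset_trans (tperm_on x y) _.
by apply/subsetP => z; rewrite !inE => /orP[] /eqP->.
Qed.

Lemma card_involutions_fix B b : b \in B ->
  #|[set s in involutions_on B | s b == b]| = #|involutions_on (B :\ b)|.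
Proof.
move=> Bb; rewrite -(@card_involutions_extending [set b] B 1%g).
- apply: eq_card => s; rewrite !inE; congr (_ && _).
  apply/idP/forall_inP => [sb x /set1P->|/(_ b (set11 b))]; rewrite perm1 //.
- by rewrite sub1set.
- by apply/involutions_onP; split; [move=> x; rewrite !perm1 | apply: perm_on1].
Qed.

Lemma card_involutions_swap B b c : b \in B -> c \in B ->
  #|[set s in involutions_on B | s b == c]|
    = #|involutions_on (B :\: [set b; c])|.
Proof.
move=> Bb Bc.
rewrite -(@card_involutions_extending [set b; c] B (tperm b c)).
- apply: eq_card => s; rewrite [LHS]in_set [RHS]in_set.
  apply: andb_id2l => /involutions_onP[sK _].
  apply/eqP/forall_inP => [sb x /set2P[]->|/(_ b (set21 b c))].
  + by rewrite tpermL sb.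
  + by rewrite tpermR -sb sK.
  + by rewrite tpermL => /eqP.
- by rewrite subUset !sub1set Bb Bc.
- by apply: tperm_involutions_on; rewrite !inE eqxx ?orbT.
Qed.

End InvolutionsOn.

(** * The recurrence for the number of involutions *)

(* The components of [invol_pair n] are the numbers of involutions of sets with
   n and n.+1 elements: a point is fixed or swapped with one of the others. *)
Fixpoint invol_pair (n : nat) : nat * nat :=
  if n is m.+1 then
    let: (a, b) := invol_pair m in (b, b + m.+1 * a)
  else (1, 1).
Definition ninvol n := (invol_pair n).1.

Lemma ninvolSS n : ninvol n.+2 = ninvol n.+1 + n.+1 * ninvol n.
Proof. by rewrite /ninvol /=; case: (invol_pair n). Qed.

(** Strong induction on the size of [B], sorting the involutions by the image of a chosen point
    [b]. *)
Lemma card_involutions_on (T : finType) (B : {set T}) :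
  #|involutions_on B| = ninvol #|B|.
Proof.
have [m] := ubnP #|B|; elim: m B => // m IH B Bm.
have [->|[b Bb]] := set_0Vmem B.
  rewrite cards0; apply/eqP/cards1P; exists 1%g; apply/setP => s.
  apply/involutions_onP/set1P => [[_ s0]|->].
    by apply/permP => x; rewrite perm1 (out_perm s0) ?inE.
  by split; [move=> x; rewrite !perm1 | apply: perm_on1].
have cB := cardsD1 b B; rewrite Bb /= in cB.
have -> : #|involutions_on B|
    = \sum_(c in B) #|[set s in involutions_on B | s b == c]|.
  rewrite -sum1_card (partition_big (fun s : {perm T} => s b) (mem B)) /=;
    last first.
    by move=> s /involutions_onP[_ Bs]; rewrite (perm_closed b Bs).
  by apply: eq_bigr => c _; rewrite -sum1dep_card.
rewrite (big_setD1 b) //= card_involutions_fix // IH; last by lia.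
have -> : \sum_(c in B :\ b) #|[set s in involutions_on B | s b == c]|
    = \sum_(c in B :\ b) ninvol (#|B| - 2).
  apply: eq_bigr => c /setD1P[cb Bc].
  have c2 : #|B :\: [set b; c]| = #|B| - 2.
    by rewrite cardsDS ?cards2 1?eq_sym ?cb // subUset !sub1set Bb Bc.
  by rewrite card_involutions_swap // IH c2 //; lia.
rewrite sum_nat_const.
(* If [b] is the only point, the sum over [c] is empty, so the truncated [#|B| - 2] does no harm,
   and [ninvol 0 = ninvol 1]. *)
case: #|B :\ b| cB => [|k] ->; first by rewrite addn0.
by rewrite !addSn add0n ninvolSS subn2.
Qed.

Lemma perm_onT (T : finType) (s : {perm T}) : perm_on [set: T] s.
Proof. by apply/subsetP => x _; rewrite inE. Qed.

Lemma involutions_setT n : involutions n = involutions_on [set: 'I_n].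
Proof. by apply/setP => s; rewrite !inE perm_onT andbT. Qed.

Lemma card_involutions n : #|involutions n| = ninvol n.
Proof. by rewrite involutions_setT card_involutions_on cardsT card_ord. Qed.

Lemma involutionsP n (s : 'S_n) : reflect (involutive s) (s \in involutions n).
Proof.
by rewrite involutions_setT; apply: (iffP (involutions_onP _ _)) => [[]|] //;
  split=> //; apply: perm_onT.
Qed.

(** * Involutions with prescribed values *)

Lemma card_involutions_map n (i j : 'I_n) : i != j ->
  #|[set s in involutions n | s i == j]| = ninvol (n - 2).
Proof.
move=> ij; rewrite involutions_setT card_involutions_swap ?inE //.
by rewrite card_involutions_on setTD cardsCs setCK cards2 ij card_ord.
Qed.

Lemma card_involutions_extending_setT n (A : {set 'I_n}) (t : 'S_n) :
  t \in involutions_on A ->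
  #|[set s in involutions n | [forall x in A, s x == t x]]| = ninvol (n - #|A|).
Proof.
move=> At; rewrite involutions_setT card_involutions_extending ?subsetT //.
by rewrite card_involutions_on setTD cardsCs setCK card_ord.
Qed.

(** Since [s] is an involution, [s i = k] forces [s k = i]; hence [s] is known on all three points,
    where it agrees with [tperm i k]. *)
Lemma card_involutions_map_fix n (i j k : 'I_n) : uniq [:: i; k; j] ->
  #|[set s in involutions n | (s i == k) && (s j == j)]| = ninvol (n - 3).
Proof.
move=> u; have <- : #|[set x in [:: i; k; j]]| = 3.
  by rewrite cardsE; apply/card_uniqP.
move: u; rewrite /= !inE negb_or andbT => /andP[/andP[ik ij] kj].
rewrite -(@card_involutions_extending_setT _ _ (tperm i k)); last first.
  by apply: tperm_involutions_on; rewrite !inE eqxx ?orbT.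
apply: eq_card => s; rewrite [LHS]in_set [RHS]in_set.
apply: andb_id2l => /involutionsP sK.
apply/andP/forall_inP => [[/eqP si /eqP sj] x|st].
  rewrite !inE => /or3P[] /eqP->; first by rewrite tpermL si.
    by rewrite tpermR -si sK.
  by rewrite tpermD ?sj.
have := st i; have := st j; rewrite !inE !eqxx ?orbT tpermL tpermD //.
by move=> -> // ->.
Qed.

(** Here [s] must agree on the four points with the product of the disjoint transpositions
    [tperm i k] and [tperm j l]. *)
Lemma card_involutions_map2 n (i j k l : 'I_n) : uniq [:: i; k; j; l] ->
  #|[set s in involutions n | (s i == k) && (s j == l)]| = ninvol (n - 4).
Proof.
move=> u; have <- : #|[set x in [:: i; k; j; l]]| = 4.
  by rewrite cardsE; apply/card_uniqP.
move: u; rewrite /= !inE !negb_or andbT.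
move=> /and3P[/and3P[ik ij il] /andP[kj kl] jl].
have dis : [disjoint [set i; k] & [set j; l]].
  by rewrite -setI_eq0; apply/eqP/setP => x; rewrite !inE;
    apply/negP => /andP[/orP[]/eqP-> /orP[]/eqP E];
    rewrite ?E eqxx in ik ij il kj kl jl.
rewrite -(@card_involutions_extending_setT _ _ (tperm i k * tperm j l)%g);
  last first.
  apply/involutions_onP; split=> [x|].
    by rewrite {1}(perm_onC (tperm_on i k) (tperm_on j l) dis) !permM !tpermK.
  have inA x y : x \in [:: i; k; j; l] -> y \in [:: i; k; j; l] ->
      perm_on [set x in [:: i; k; j; l]] (tperm x y).
    move=> xA yA; apply: subset_trans (tperm_on x y) _.
    by apply/subsetP => z /set2P[] ->; rewrite inE.
  by apply: perm_onM; apply: inA; rewrite !inE eqxx ?orbT.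
apply: eq_card => s; rewrite [LHS]in_set [RHS]in_set.
apply: andb_id2l => /involutionsP sK.
have [ti tk] : (tperm i k * tperm j l)%g i = k
    /\ (tperm i k * tperm j l)%g k = i.
  by rewrite !permM tpermL tpermR !tpermD // eq_sym.
have [tj tl] : (tperm i k * tperm j l)%g j = l
    /\ (tperm i k * tperm j l)%g l = j.
  by rewrite !permM !(@tpermD _ i k) // tpermL tpermR.
apply/andP/forall_inP => [[/eqP si /eqP sj] x|st].
  rewrite !inE => /or4P[] /eqP->; rewrite ?ti ?tk ?tj ?tl ?si ?sj //.
    by rewrite -si sK.
  by rewrite -sj sK.
have := st i; have := st j; rewrite !inE !eqxx ?orbT ti tj.
by move=> -> // ->.
Qed.

(** * Counting the configurations *)

Lemma card_sum_mem (I : finType) (D : {set I}) : #|D| = \sum_i (i \in D).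
Proof. by rewrite -sum1_card big_mkcond. Qed.

Lemma double_counting (S I : finType) (X : {set S}) (D : {set I})
    (R : S -> I -> bool) c :
  (forall p, p \in D -> #|[set s in X | R s p]| = c) ->
  \sum_(s in X) #|[set p in D | R s p]| = #|D| * c.
Proof.
move=> Rc; under eq_bigr do rewrite -sum1dep_card big_mkcondr.
rewrite exchange_big -sum_nat_const; apply: eq_bigr => p Dp.
by rewrite -big_mkcondr sum1dep_card Rc.
Qed.

(** The square of [A] splits into the pairs below, above and on the diagonal; exchanging coordinates
    matches the first two kinds, so twice the count plus [#|A|] is [#|A| * #|A|]. *)
Lemma card_lt_pairs_in n (A : {set 'I_n}) :
  #|[set p : 'I_n * 'I_n | [&& p.1 \in A, p.2 \in A & p.1 < p.2]]|
    = 'C(#|A|, 2).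
Proof.
set U := [set p | _].
pose L := [set p : 'I_n * 'I_n | [&& p.1 \in A, p.2 \in A & p.2 < p.1]].
pose E := [set p : 'I_n * 'I_n | [&& p.1 \in A, p.2 \in A & p.1 == p.2]].
have LU : #|L| = #|U|.
  pose f (p : 'I_n * 'I_n) := (p.2, p.1).
  have fI : injective f by move=> [a b] [c d] [-> ->].
  rewrite -(card_imset (mem U) fI); apply: eq_card => -[x y].
  apply/idP/imsetP => [|[[u v] + [-> ->]]]; last by rewrite !inE /= andbCA.
  by rewrite inE /= andbCA => Lxy; exists (y, x); rewrite ?inE.
have EA : #|E| = #|A|.
  have inj : injective (fun x : 'I_n => (x, x)) by move=> x y [].
  rewrite -(card_imset (mem A) inj); apply: eq_card => -[x y].
  apply/idP/imsetP => [|[z Az [-> ->]]]; last by rewrite !inE /= Az eqxx.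
  by rewrite inE /= => /and3P[Ax _ /eqP<-]; exists x.
have AA : #|A| * #|A| = #|U| + #|L| + #|E|.
  rewrite -cardsX !card_sum_mem -!big_split /=; apply: eq_bigr => -[x y] _.
  rewrite !inE /= -val_eqE /=.
  by case: (x \in A) (y \in A) => [] [] //=; case: ltngtP.
rewrite LU EA in AA; rewrite bin2; nia.
Qed.

Definition lt_pairs n := [set p : 'I_n * 'I_n | p.1 < p.2].
Definition lt_triples n := [set q : 'I_n * 'I_n * 'I_n | q.1.1 < q.1.2 < q.2].
(** An element stands for [((i, j), (s j, s i))] with [i < j] an inversion of [s], so both pairs
    increase. The list has the order [i], [s i], [j], [s j] expected by [card_involutions_map2]. *)
Definition disjoint_lt_pairs n :=
  [set q : ('I_n * 'I_n) * ('I_n * 'I_n) |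
    [&& q.1.1 < q.1.2, q.2.1 < q.2.2 & uniq [:: q.1.1; q.2.2; q.1.2; q.2.1]]].

Lemma card_lt_pairs n : #|lt_pairs n| = 'C(n, 2).
Proof.
rewrite -[in RHS](card_ord n) -cardsT -card_lt_pairs_in.
by apply: eq_card => p; rewrite !inE.
Qed.

(** Group the triples by their largest entry [k]: the other two form an increasing pair among the
    [k] smaller elements. *)
Lemma card_lt_triples n : #|lt_triples n| = 'C(n, 3).
Proof.
have -> : 'C(n, 3) = \sum_(k < n) 'C(k, 2).
  by elim: n => [|n IH]; rewrite ?big_ord0 // big_ord_recr /= -IH binS addnC.
rewrite -sum1dep_card; under eq_bigl do rewrite andbC.
under [RHS]eq_bigr => k _.
  have ck : #|[set x : 'I_n | x < k]| = k.
    rewrite -sum1dep_card -(big_ord_widen n (fun _ => 1)) 1?ltnW //.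
    by rewrite sum1_card card_ord.
  rewrite -{1}ck -card_lt_pairs_in -sum1dep_card.
over.
rewrite pair_big_dep /=.
rewrite (reindex (fun q : 'I_n * ('I_n * 'I_n) => (q.2, q.1))) /=; last first.
  by exists (fun q => (q.2, q.1)) => [] [].
by apply: eq_bigl => -[k [x y]]; rewrite !inE /=; lia.
Qed.

Lemma card_disjoint_lt_pairs n : #|disjoint_lt_pairs n| = 6 * 'C(n, 4).
Proof.
have -> : 6 * 'C(n, 4) = 'C(n, 2) * 'C(n - 2, 2).
  case: n => [|[|n]] //; rewrite !subSS subn0.
  (* In falling factorials, with [N = n.+2], both sides are N(N-1)(N-2)(N-3)/4. *)
  have := bin_ffact n.+2 4; have := bin_ffact n.+2 2; have := bin_ffact n 2.
  by rewrite !ffactSS !ffactn0 (_ : 2`! = 2) // (_ : 4`! = 24) //; nia.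
rewrite -card_lt_pairs -sum_nat_const.
under [RHS]eq_bigr => p.
  rewrite inE => lt_p.
  have cA : #|~: [set p.1; p.2]| = n - 2.
    by rewrite cardsCs setCK cards2 neq_ltn lt_p card_ord.
  rewrite -cA -card_lt_pairs_in -sum1dep_card.
over.
rewrite pair_big_dep sum1dep_card /=; apply: eq_card => -[[i j] [l k]].
rewrite !inE /= !inE -!val_eqE /=; lia.
Qed.

(* For an inversion i < j, the two equal summands are the cases s i = i and
   s j = j. *)
Lemma inv_involution n (s : 'S_n) : involutive s ->
  Defs.inv s = #|[set p in lt_pairs n | s p.1 == p.2]|
    + #|[set q in lt_triples n | (s q.1.1 == q.2) && (s q.1.2 == q.1.2)]|
    + #|[set q in lt_triples n | (s q.1.1 == q.2) && (s q.1.2 == q.1.2)]|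
    + #|[set q in disjoint_lt_pairs n
          | (s q.1.1 == q.2.2) && (s q.1.2 == q.2.1)]|.
Proof.
move=> sK; set M := [set p in lt_pairs n | _].
set F := [set q in lt_triples n | _].
set G := [set q in disjoint_lt_pairs n | _].
have inj : injective s by apply: inv_inj.
have -> : #|G| = #|[set p : 'I_n * 'I_n |
    [&& p.1 < p.2, s p.2 < s p.1 & uniq [:: p.1; s p.1; p.2; s p.2]]]|.
  pose f (p : 'I_n * 'I_n) := (p, (s p.2, s p.1)).
  have fI : injective f by move=> p q [].
  rewrite -(card_imset (mem [set p | _]) fI); apply: eq_card => -[[i j] [l k]].
  apply/idP/imsetP => [|[[a b] + [-> -> -> ->]]]; last first.
    by rewrite !inE /= !eqxx !andbT.
  rewrite inE /= => /and3P[+ /eqP si /eqP sj]; rewrite inE /= => H.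
  by exists (i, j); [rewrite inE /= si sj | rewrite /f /= si sj].
(* Left endpoint fixed: the inversion [(i, j)] gives the triple [s j < i < j], whose outer points
   are swapped. *)
have F1 : #|F| = #|[set p : 'I_n * 'I_n |
    [&& p.1 < p.2, s p.2 < p.1 & s p.1 == p.1]]|.
  pose f (p : 'I_n * 'I_n) := (s p.2, p.1, p.2).
  have fI : injective f by move=> [a b] [c d] [_ -> ->].
  rewrite -(card_imset (mem [set p | _]) fI); apply: eq_card => -[[i j] k].
  apply/idP/imsetP => [|[[a b] + [-> -> ->]]].
    rewrite inE /= => /and3P[+ /eqP si /eqP sj]; rewrite inE /= => /andP[ij jk].
    by exists (j, k); rewrite ?inE /f /= -?si sK ?sj ?eqxx ?andbT // ij si jk.
  by rewrite !inE /= sK eqxx => /and3P[-> -> ->].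
(* Right endpoint fixed: the triple is [i < j < s i]. *)
have F2 : #|F| = #|[set p : 'I_n * 'I_n |
    [&& p.1 < p.2, p.2 < s p.1 & s p.2 == p.2]]|.
  pose f (p : 'I_n * 'I_n) := (p.1, p.2, s p.1).
  have fI : injective f by move=> [a b] [c d] [-> ->].
  rewrite -(card_imset (mem [set p | _]) fI); apply: eq_card => -[[i j] k].
  apply/idP/imsetP => [|[[a b] + [-> -> ->]]].
    rewrite inE /= => /and3P[+ /eqP si /eqP sj]; rewrite inE /= => /andP[ij jk].
    by exists (i, j); rewrite ?inE /f /= si ?sj ?eqxx ?andbT // ij jk.
  by rewrite !inE /= eqxx => /and3P[-> -> ->].
(* One copy of [#|F|] is read with the left endpoint fixed, the other with the right. All terms then
   count pairs [(i, j)], and the identity is checked pair by pair. *)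
rewrite {1}F1 F2 /Defs.inv !card_sum_mem -!big_split /=.
apply: eq_bigr => -[i j] _; rewrite /lt_pairs !inE /=.
(* The involution enters the arithmetic only through these two equivalences between equalities of
   points. *)
have sji : (s j == i) = (s i == j) by rewrite (can2_eq sK sK) eq_sym.
have sij : (s i == s j) = (i == j) by apply: inj_eq.
move: sji sij; rewrite [s i == i]eq_sym -!val_eqE /=.
move: (nat_of_ord i) (nat_of_ord j) (nat_of_ord (s i)) (nat_of_ord (s j)).
move=> a b c d.
case: (ltngtP a b) => //= ab; lia.
Qed.

(** For [n < k] the binomial vanishes, which hides the difference between the integer index and the
    truncated [n - k]. *)
Lemma bin_mul_r1 n k :
  'C(n, k) * r1 (n%:Z - k%:Z)%R = 'C(n, k) * ninvol (n - k).
Proof.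
have [le_kn|lt_nk] := leqP k n; last by rewrite bin_small.
by rewrite subzn //= card_involutions.
Qed.

Theorem theorem5p2 (n : nat) :
  i1 n = 'C(n, 2) * r1 (n%:Z - 2)%R
         + 2 * 'C(n, 3) * r1 (n%:Z - 3)%R
         + 6 * 'C(n, 4) * r1 (n%:Z - 4)%R.
Proof.
rewrite -!mulnA (bin_mul_r1 n 2) (bin_mul_r1 n 3) (bin_mul_r1 n 4) /i1.
under eq_bigr => s /involutionsP sK do rewrite inv_involution //.
rewrite !big_split /=.
rewrite (@double_counting _ _ _ (lt_pairs n) _ (ninvol (n - 2))); last first.
  move=> p; rewrite inE => lt_p.
  by rewrite card_involutions_map // neq_ltn lt_p.
(* This evaluates both of the equal sums over triples, whence the coefficient 2. *)
rewrite (@double_counting _ _ _ (lt_triples n) _ (ninvol (n - 3))); last first.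
  move=> [[i j] k]; rewrite inE /= => /andP[ij jk].
  by apply: card_involutions_map_fix; rewrite /= !inE -!val_eqE /=; lia.
rewrite (@double_counting _ _ _ (disjoint_lt_pairs n) _ (ninvol (n - 4)));
  last first.
  move=> [[i j] [l k]]; rewrite inE => /and3P[_ _].
  exact: card_involutions_map2.
rewrite card_lt_pairs card_lt_triples card_disjoint_lt_pairs; lia.
Qed.
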